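(* There are infinitely many finite simple groups $G$ (up to isomorphism) with $\delta_{\mathcal{S}}(G) = 2$.
   Context: Simple groups here are non-abelian. For a finite insoluble group $G$ with soluble radical $R(G)$ (the largest soluble normal subgroup), the soluble graph $\Gamma_{\mathcal{S}}(G)$ has vertex set $G \setminus R(G)$, with distinct vertices $x,y$ adjacent if and only if the subgroup $\langle x,y\rangle$ is soluble. Its diameter is denoted $\delta_{\mathcal{S}}(G)$ (with $\delta_{\mathcal{S}}(G)=\infty$ if the graph is disconnected). *)

(* Defs.v *)
From mathcomp Require Import all_boot all_fingroup all_solvable.
Set Implicit Arguments.
Unset Strict Implicit.
Unset Printing Implicit Defensive.

(* Distances and diameters for the graph with edge relation [e] on a set [V]
   of vertices. When used below, [e] only relates elements of [V]. *)
Section Graph.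
Variables (T : finType) (e : rel T).

Definition walk (n : nat) (x y : T) : bool :=
  [exists p : n.-tuple T, path e x p && (last x p == y)].

(* Only meaningful when [connect e x y] holds; a shortest path then has fewer
   than [#|T|] edges, so the search below succeeds (see [gdist_walk]). *)
Definition gdist (x y : T) : nat := find (fun n => walk n x y) (iota 0 #|T|).

(* [None] stands for an infinite diameter. *)
Definition diameter (V : {set T}) : option nat :=
  if [forall x in V, forall y in V, connect e x y]
  then Some (\max_(x in V) \max_(y in V) gdist x y)
  else None.

Lemma walkP n x y :
  reflect (exists2 p, size p = n & path e x p /\ last x p = y) (walk n x y).
Proof.
apply: (iffP existsP) => [[p /andP[ep /eqP lp]]|[p sp [ep lp]]].
  by exists p; rewrite ?size_tuple.
by move/eqP: sp => sp; exists (Tuple sp); rewrite ep lp eqxx.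
Qed.

Lemma gdist_walk x y : connect e x y -> walk (gdist x y) x y.
Proof.
case/connectP=> p0 ep0 ->; case/shortenP: ep0 => p ep up _.
have w : walk (size p) x (last x p) by apply/walkP; exists p.
have lt_p : size p < #|T| by move: (card_uniqP up) => /= <-; exact: max_card.
have h : has (fun n => walk n x (last x p)) (iota 0 #|T|).
  by apply/hasP; exists (size p); rewrite ?mem_iota.
have := nth_find 0 h; rewrite nth_iota //.
by rewrite has_find size_iota in h.
Qed.

Lemma gdist_min n x y : walk n x y -> gdist x y <= n.
Proof.
move=> w; rewrite leqNgt; apply/negP => lt_n.
have lt_nT : n < #|T|.
  by apply: leq_trans lt_n _; rewrite -[leqRHS](size_iota 0); apply: find_size.
by have := before_find 0 lt_n; rewrite nth_iota // w.
Qed.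

End Graph.

Section SolubleGraph.
Local Open Scope group_scope.
Variable gT : finGroupType.
Implicit Types (G H : {group gT}) (x y : gT).

Definition sol_radical G : {group gT} :=
  (\prod_(H : {group gT} | (H <| G) && solvable H) H)%G.

Lemma sol_radical_spec G : (sol_radical G <| G) && solvable (sol_radical G).
Proof.
apply: (big_ind (fun H : {group gT} => (H <| G) && solvable H)) => //.
  by rewrite normal1 solvable1.
move=> H K /andP[nHG sH] /andP[nKG sK]; rewrite /= normalY //=.
have nKHK : K <| K <*> H.
  rewrite normalYl; apply: subset_trans (normal_norm nKG).
  exact: normal_sub.
rewrite joingC (series_sol nKHK) sK /= quotientYidl.
  exact: quotient_sol.
by apply: subset_trans (normal_norm nKG); exact: normal_sub.
Qed.

Lemma sol_radical_max G H : H <| G -> solvable H -> H \subset sol_radical G.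
Proof. by move=> nHG sH; rewrite /sol_radical (bigD1 H) ?nHG //= joing_subl. Qed.

Definition soluble_graph_vertices G : {set gT} := G :\: sol_radical G.

Definition soluble_graph_adj G : rel gT := fun x y =>
  [&& x \in soluble_graph_vertices G, y \in soluble_graph_vertices G,
      x != y & solvable <<[set x; y]>>].

Definition soluble_graph_diameter G : option nat :=
  diameter (soluble_graph_adj G) (soluble_graph_vertices G).

End SolubleGraph.

(* Main.v *)
From HB Require Import structures.
Require Import Defs.
From mathcomp Require Import all_boot all_fingroup all_solvable.
From mathcomp Require Import all_algebra finfield ring.

(** Let [G = SL(2, q)] with [q] a power of 4. For [x, y] in [G] the matrix
    [z = xy - yx] has trace 0 and [tr(zx) = tr(zy) = 0], so [zx = adj(x) z] and
    [zy = adj(y) z]. If [det z != 0], dividing [z] by a square root of [det z]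
    (available in characteristic 2) gives an element of [G] inverting both [x]
    and [y], hence a common neighbour. If [det z = 0], then [x] and [y] commute
    or fix a common line, and they generate a soluble group. So any two vertices
    are at distance at most 2, and distance 2 occurs because [G] contains a
    (2,3,5)-generated, hence perfect, subgroup over the field of order 4. *)

Set Implicit Arguments.
Unset Strict Implicit.
Unset Printing Implicit Defensive.
Import GRing.Theory.

(** * Graphs of diameter two *)

Lemma diameter2 (T : finType) (e : rel T) (V : {set T}) :
    (forall x y, x \in V -> y \in V -> x != y -> ~~ e x y ->
      exists2 z, e x z & e z y) ->
    (exists x y, [/\ x \in V, y \in V, x != y & ~~ e x y]) ->
  diameter e V = Some 2.
Proof.
move=> common [x0 [y0 [Vx0 Vy0 neq0 nadj0]]].
have walk2 x y : x \in V -> y \in V -> exists2 n, n <= 2 & walk e n x y.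
  move=> Vx Vy; have [-> | neq] := eqVneq x y.
    by exists 0 => //; apply/walkP; exists [::].
  have [adj | nadj] := boolP (e x y).
    by exists 1%N => //; apply/walkP; exists [:: y]; rewrite //= adj.
  have [z exz ezy] := common x y Vx Vy neq nadj.
  by exists 2 => //; apply/walkP; exists [:: z; y]; rewrite //= exz ezy.
have conn x y : x \in V -> y \in V -> connect e x y.
  move=> Vx Vy; have [n _ /walkP[p _ [ep lp]]] := walk2 x y Vx Vy.
  by apply/connectP; exists p.
have gd x y : x \in V -> y \in V -> gdist e x y <= 2.
  by move=> Vx Vy; have [n le2 /gdist_min/leq_trans->] := walk2 x y Vx Vy.
rewrite /diameter ifT; last by apply/forall_inP=> x ?; apply/forall_inP=> y; auto.
congr Some; apply/eqP; rewrite eqn_leq; apply/andP; split.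
  by apply/bigmax_leqP=> x Vx; apply/bigmax_leqP=> y Vy; apply: gd.
rewrite (bigmax_sup x0) // (bigmax_sup y0) // leqNgt.
apply: contra (nadj0) => lt2; have /walkP[p sp [ep lp]] := gdist_walk (conn _ _ Vx0 Vy0).
case: p sp ep lp => [_ _ /eqP | z [|? ?] sp] /=; first by rewrite (negPf neq0).
  by rewrite andbT => exz <-.
by rewrite -sp in lt2.
Qed.

(** * Solubility of groups generated by two elements *)

Section TwoGenerators.
Local Open Scope group_scope.
Variable gT : finGroupType.
Implicit Types x y : gT.

Lemma gen2C x y : <<[set x; y]>> = <<[set y; x]>>.
Proof. by rewrite setUC. Qed.

(** Here [y] normalises [<[x]>], so the group is cyclic-by-cyclic. *)
Lemma sol_norm_cycle x y : x ^ y \in <[x]> -> solvable <<[set x; y]>>.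
Proof.
rewrite -norms_cycle => nxy.
have -> : <<[set x; y]>> = <[x]> <*> <[y]> by rewrite joing_idl joing_idr.
have nx : <[x]> <| <[x]> <*> <[y]>.
  by rewrite /normal joing_subl join_subG normG nxy.
rewrite (series_sol nx) abelian_sol ?cycle_abelian //= quotientYidl //.
by rewrite quotient_sol // abelian_sol ?cycle_abelian.
Qed.

(** The group is dihedral (possibly degenerate): [y] inverts [x * y]. *)
Lemma sol_invol x y : x^-1 = x -> y^-1 = y -> solvable <<[set x; y]>>.
Proof.
move=> xV yV; have: solvable <<[set x * y; y]>>.
  have y2 : y * y = 1 by rewrite -{1}yV mulVg.
  apply: sol_norm_cycle; suff -> : (x * y) ^ y = (x * y)^-1.
    by rewrite groupV cycle_id.
  by rewrite conjgE invMg xV -!mulgA y2 mulg1 yV.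
apply: solvableS; rewrite gen_subG subUset !sub1set.
have memy : y \in <<[set x * y; y]>> by rewrite mem_gen // !inE eqxx orbT.
by rewrite -{1}[x](mulgK y) groupM ?groupV ?memy // mem_gen // !inE eqxx.
Qed.

(* The exponents 2, 3, 5 are pairwise coprime, so the group is perfect. *)
Lemma gen235_nonsol x y :
    x ^+ 2 = 1 -> y ^+ 3 = 1 -> (x * y) ^+ 5 = 1 -> y != 1 ->
  ~~ solvable <<[set x; y]>>.
Proof.
move=> x2 y3 xy5 nty; apply/negP=> solH; set H := <<[set x; y]>> in solH.
have Hx : x \in H by rewrite mem_gen // !inE eqxx.
have Hy : y \in H by rewrite mem_gen // !inE eqxx orbT.
have ntH : H != 1.
  by apply: contra nty => /eqP H1; rewrite H1 inE in Hy.
have:= sol_der1_proper solH (subxx H) ntH; rewrite properE => /andP[_ /negP[]].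
have nH : H \subset 'N(H^`(1)) by apply: der_norm.
have [Nx Ny] : x \in 'N(H^`(1)) /\ y \in 'N(H^`(1)).
  by rewrite !(subsetP nH).
pose f := coset H^`(1).
have fx2 : f x ^+ 2 = 1 by rewrite -morphX // x2 morph1.
have fy3 : f y ^+ 3 = 1 by rewrite -morphX // y3 morph1.
have cxy : commute (f x) (f y).
  by apply: (centsP (der_abelian 0 [group of H])); rewrite mem_quotient.
have fxy5 : f x ^+ 5 * f y ^+ 5 = 1.
  by rewrite -expgMn // -morphM // -morphX ?groupM // xy5 morph1.
(* Reducing the exponents modulo 2 and 3 in [fxy5] leaves [f x * f y ^+ 2 = 1 = f y ^+ 3]. *)
have fxy : f x = f y.
  apply: (mulIg (f y ^+ 2)); rewrite -expgS fy3 -fxy5.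
  by rewrite (expgD _ 4 1) (expgD (f y) 3 2) (expgM _ 2 2) fx2 fy3 expg1n !mul1g.
have fy1 : f y = 1.
  by rewrite -fxy in fy3 *; rewrite -[RHS]fy3 expgS fx2 mulg1.
rewrite gen_subG subUset !sub1set.
by apply/andP; split; apply: coset_idr; rewrite -/f ?fxy.
Qed.

End TwoGenerators.

(** * The group SL(2, F) and its Borel subgroup *)

Section SL2Group.
Variable F : finFieldType.
Local Open Scope group_scope.
Local Open Scope ring_scope.

(** Matrices are quadruples of entries, row by row, so that matrix identities become coordinate
    goals for [ring]. *)
Definition det2 (m : F * F * F * F) : F :=
  let: (a, b, c, d) := m in a * d - b * c.

Record sl2 := SL2 { sl2_mx : F * F * F * F; _ : det2 sl2_mx == 1 }.

HB.instance Definition _ := [isSub for sl2_mx].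
HB.instance Definition _ := [Finite of sl2 by <:].

Definition mul2 (m n : F * F * F * F) : F * F * F * F :=
  let: (a, b, c, d) := m in let: (p, q, r, s) := n in
  (a * p + b * r, a * q + b * s, c * p + d * r, c * q + d * s).

Definition adj2 (m : F * F * F * F) : F * F * F * F :=
  let: (a, b, c, d) := m in (d, - b, - c, a).

Lemma det2M m n : det2 (mul2 m n) = det2 m * det2 n.
Proof. by case: m n => [[[a b] c] d] [[[p q] r] s] /=; ring. Qed.

Fact sl2_one_subproof : det2 (1, 0, 0, 1) == 1.
Proof. by apply/eqP => /=; ring. Qed.
Definition sl2_one := SL2 sl2_one_subproof.

Fact sl2_mul_subproof (x y : sl2) : det2 (mul2 (val x) (val y)) == 1.
Proof. by rewrite det2M (eqP (valP x)) (eqP (valP y)) mulr1. Qed.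
Definition sl2_mul x y := SL2 (sl2_mul_subproof x y).

Fact sl2_inv_subproof (x : sl2) : det2 (adj2 (val x)) == 1.
Proof.
by case: x => [[[[a b] c] d] /= /eqP det_x]; apply/eqP; rewrite -det_x; ring.
Qed.
Definition sl2_inv x := SL2 (sl2_inv_subproof x).

Fact sl2_mulA : associative sl2_mul.
Proof.
move=> [[[[a b] c] d] ?] [[[[p q] r] s] ?] [[[[t u] v] w] ?]; apply: val_inj => /=.
by congr (_, _, _, _); ring.
Qed.

Fact sl2_mul1 : left_id sl2_one sl2_mul.
Proof.
by move=> [[[[a b] c] d] ?]; apply: val_inj => /=; congr (_, _, _, _); ring.
Qed.

Fact sl2_mulV : left_inverse sl2_one sl2_inv sl2_mul.
Proof.
move=> [[[[a b] c] d] /= H]; apply: val_inj => /=.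
by congr (_, _, _, _); rewrite -?(eqP H); ring.
Qed.

Fact sl2_mulr1 : right_id sl2_one sl2_mul.
Proof.
by move=> [[[[a b] c] d] ?]; apply: val_inj => /=; congr (_, _, _, _); ring.
Qed.

Fact sl2_mulrV : right_inverse sl2_one sl2_inv sl2_mul.
Proof.
move=> [[[[a b] c] d] /= H]; apply: val_inj => /=.
by congr (_, _, _, _); rewrite -?(eqP H); ring.
Qed.

HB.instance Definition _ := isGroup.Build sl2
  sl2_mulA sl2_mul1 sl2_mulr1 sl2_mulV sl2_mulrV.

Implicit Types (x y z : sl2) (m : F * F * F * F).

(** The identity is the fallback value when the determinant is not 1. *)
Definition sl2_of m : sl2 := insubd (1%g : sl2) m.

Lemma val_sl2_of m : det2 m = 1 -> val (sl2_of m) = m.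
Proof. by move/eqP=> det_m; rewrite /sl2_of insubdK. Qed.

Lemma sl2_det x : det2 (val x) = 1. Proof. exact: (eqP (valP x)). Qed.

Lemma val_sl2M x y : val (x * y)%g = mul2 (val x) (val y). Proof. by []. Qed.
Lemma val_sl2V x : val x^-1%g = adj2 (val x). Proof. by []. Qed.
Lemma val_sl21 : val (1%g : sl2) = (1, 0, 0, 1). Proof. by []. Qed.

Let valE := (val_sl2M, val_sl2V, val_sl21).

(** With matrices acting on row vectors from the right, this is the stabiliser of the line of (0,
    1). *)
Definition borel := [set x : sl2 | let: (_, _, c, _) := val x in c == 0].
Definition unitri :=
  [set x : sl2 | let: (a, _, c, d) := val x in [&& a == 1, c == 0 & d == 1]].

Fact borel_group_set : group_set borel.
Proof.
apply/group_setP; split=> [|x y]; first by rewrite inE /= eqxx.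
rewrite !inE valE; case: (val x) (val y) => [[[a b] c] d] [[[p q] r] s] /=.
by move=> /eqP-> /eqP->; rewrite mul0r mulr0 addr0.
Qed.
Canonical borel_group := Group borel_group_set.

Fact unitri_group_set : group_set unitri.
Proof.
apply/group_setP; split=> [|x y]; first by rewrite inE /= !eqxx.
rewrite !inE valE; case: (val x) (val y) => [[[a b] c] d] [[[p q] r] s] /=.
move=> /and3P[/eqP-> /eqP-> /eqP->] /and3P[/eqP-> /eqP-> /eqP->].
by rewrite !(mul1r, mul0r, mulr0, addr0, add0r) !eqxx.
Qed.
Canonical unitri_group := Group unitri_group_set.

Lemma unitri_abelian : abelian unitri.
Proof.
apply/centsP=> x; rewrite inE => Ux y; rewrite inE => Uy.
apply/val_inj; rewrite !valE; move: Ux Uy.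
case: (val x) (val y) => [[[a b] c] d] [[[p q] r] s] /=.
move=> /and3P[/eqP-> /eqP-> /eqP->] /and3P[/eqP-> /eqP-> /eqP->].
by congr (_, _, _, _); ring.
Qed.

(** Diagonal entries of upper triangular matrices multiply entrywise, so those of a commutator
    cancel to 1. *)
Lemma borel_der1 : [~: borel, borel] \subset unitri.
Proof.
rewrite gen_subG; apply/subsetP=> _ /imset2P[x y Bx By ->].
rewrite inE in Bx; rewrite inE in By; rewrite inE /commg /conjg !valE.
have := sl2_det x; have := sl2_det y; move: Bx By.
case: (val x) (val y) => [[[a b] c] d] [[[p q] r] s] /=.
move=> /eqP-> /eqP->; rewrite !(mulr0, subr0) => ps ad.
apply/and3P; split; apply/eqP; [|ring|].
  by rewrite -[RHS]mulr1 -{2}ps -ad; ring.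
by rewrite -[RHS]mulr1 -{2}ps -ad; ring.
Qed.

Lemma borel_sol : solvable borel.
Proof.
have sUB : unitri \subset borel.
  apply/subsetP=> x; rewrite !inE; case: (val x) => [[[a b] c] d].
  by case/and3P.
have nUB : unitri_group <| borel_group.
  by rewrite /normal sUB -commg_subr (subset_trans _ borel_der1) // commgS.
by rewrite (series_sol nUB) !abelian_sol ?unitri_abelian ?sub_der1_abelian
  ?borel_der1.
Qed.

End SL2Group.

(** * Soluble pairs and common neighbours in SL(2, F) *)

Section SL2Graph.
Variable F : finFieldType.
Implicit Types x y z : sl2 F.
Let valE := (val_sl2M, val_sl2V, val_sl21).
Local Open Scope group_scope.
Local Open Scope ring_scope.

(* The hypothesis says that x and y fix the line of the row vector (v1, v2). If g
   maps (0, 1) to it, then x ^ g^-1 and y ^ g^-1 fix the line of (0, 1). *)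
Lemma sol_common_line x y (v1 v2 : F) : (v1, v2) != (0, 0) ->
    (forall u, u \in [:: x; y] -> let: (a, b, c, d) := val u in
      (v1 * a + v2 * c) * v2 = (v1 * b + v2 * d) * v1) ->
  solvable <<[set x; y]>>.
Proof.
move=> v0 line.
have [g vg] : exists g : sl2 F, exists a b, val g = (a, b, v1, v2).
  have [v20 | v2N0] := eqVneq v2 0.
    have v1N0 : v1 != 0 by move: v0; rewrite v20 xpair_eqE eqxx andbT.
    exists (sl2_of (0, - v1^-1, v1, v2)), 0, (- v1^-1).
    by rewrite val_sl2_of //= mul0r sub0r mulNr opprK mulVf.
  exists (sl2_of (v2^-1, 0, v1, v2)), v2^-1, 0.
  by rewrite val_sl2_of //= mul0r subr0 mulVf.
have conjB u : u \in [:: x; y] -> (u ^ g^-1 \in borel F)%g.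
  move/line; rewrite inE /conjg invgK !valE; case: vg => p [q ->].
  case: (val u) => [[[a b] c] d] /= eq_line.
  (* The lower left entry of [u ^ g^-1] is the difference of the two sides of [eq_line]. *)
  rewrite -(subrr ((v1 * b + v2 * d) * v1)) -{1}eq_line.
  by apply/eqP; ring.
have sol : solvable (borel_group F :^ g)%g.
  by rewrite -(isog_sol (conj_isog (borel_group F) g)) borel_sol.
apply: solvableS sol; rewrite gen_subG subUset !sub1set !mem_conjg.
by rewrite !conjB // !inE eqxx ?orbT.
Qed.

Definition sub2 (m n : F * F * F * F) : F * F * F * F :=
  let: (a, b, c, d) := m in let: (p, q, r, s) := n in
  (a - p, b - q, c - r, d - s).

Definition sl2_bracket x y := sub2 (val (x * y)%g) (val (y * x)%g).

(** The bracket [z] satisfies [zu = adj(u) z] for [u] equal to [x] or [y], so both preserve its row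
    space. If [z] is singular and nonzero, this is a common line, spanned by any nonzero row; if
    [z = 0], then [x] and [y] commute. *)
Lemma sol_bracket_sing x y : det2 (sl2_bracket x y) = 0 -> solvable <<[set x; y]>>.
Proof.
(* The relations say that the bracket has trace 0, and so has its product with [u]. *)
have [p [q [r [s [xy_eq rel]]]]] : exists p q r s, sl2_bracket x y = (p, q, r, s) /\
    forall u, u \in [:: x; y] -> let: (a, b, c, d) := val u in
      s = - p /\ (p * a + q * c + r * b - p * d = 0).
  rewrite /sl2_bracket !valE; case Ex: (val x) => [[[a b] c] d].
  case Ey: (val y) => [[[a' b'] c'] d'] /=.
  do 4![eexists]; split=> [//|u]; rewrite !inE => /orP[]/eqP->.
    by rewrite Ex; split; ring.
  by rewrite Ey; split; ring.
rewrite xy_eq /= => det0.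
have Ds : s = - p.
  by have := rel x (mem_head _ _); case: (val x) => [[[? ?] ?] ?] [].
rewrite {}Ds in xy_eq det0.
have line_q u : u \in [:: x; y] -> let: (a, b, c, d) := val u in
    (p * a + q * c) * q = (p * b + q * d) * p.
  move/rel; case: (val u) => [[[a b] c] d] [_ tr0].
  apply/eqP; rewrite -subr_eq0; apply/eqP.
  (* A combination of that trace and of the determinant, both zero. *)
  transitivity (q * (p * a + q * c + r * b - p * d) + b * (p * - p - q * r)).
    by ring.
  by rewrite tr0 det0 !mulr0 addr0.
have line_r u : u \in [:: x; y] -> let: (a, b, c, d) := val u in
    (r * a + - p * c) * - p = (r * b + - p * d) * r.
  move/rel; case: (val u) => [[[a b] c] d] [_ tr0].
  apply/eqP; rewrite -subr_eq0; apply/eqP.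
  transitivity (- r * (p * a + q * c + r * b - p * d) - c * (p * - p - q * r)).
    by ring.
  by rewrite tr0 det0 !mulr0 subr0.
have [/eqP[p0 q0]|] := boolP ((p, q) == (0, 0)); last first.
  by move/sol_common_line; apply.
have [/eqP[r0 _]|] := boolP ((r, - p) == (0, 0)); last first.
  by move/sol_common_line; apply.
apply: sol_norm_cycle; suff -> : (x ^ y = x)%g by apply: cycle_id.
apply/conjg_fixP/commgP/val_inj.
move: xy_eq; rewrite /sl2_bracket p0 q0 r0 oppr0.
case: (val (x * y)%g) (val (y * x)%g) => [[[a b] c] d] [[[a' b'] c'] d'] /= [].
by do 4![move/eqP; rewrite subr_eq0 => /eqP->].
Qed.

(* The bracket xy - yx is orthogonal to 1, x and y for the trace form, so it
   conjugates x and y to their adjugates. *)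
Lemma inverted_by_bracket x y z s :
    val z = (let: (p, q, r, w) := sl2_bracket x y in (p / s, q / s, r / s, w / s)) ->
  (x ^ z = x^-1)%g /\ (y ^ z = y^-1)%g.
Proof.
rewrite /sl2_bracket !valE => val_z.
suff [Ex Ey] : (x * z = z * x^-1)%g /\ (y * z = z * y^-1)%g.
  by rewrite /conjg Ex Ey !mulKg.
split; apply/val_inj; rewrite !valE val_z;
  case: (val x) (val y) => [[[a b] c] d] [[[a' b'] c'] d'] /=;
  by congr (_, _, _, _); ring.
Qed.

Hypothesis pchar2 : 2%N \in [pchar F].

(** The Frobenius map is injective, hence bijective on a finite field. *)
Lemma sqrt_pchar2 (m : F) : exists s, s ^+ 2 = m.
Proof.
have inj : injective (pFrobenius_aut pchar2) by apply: fmorph_inj.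
by exists (invF inj m); rewrite -(pFrobenius_autE pchar2) f_invF.
Qed.

Lemma common_neighbour x y : ~~ solvable <<[set x; y]>> ->
  exists z, [/\ z != 1%g, solvable <<[set x; z]>> & solvable <<[set z; y]>>].
Proof.
move=> nsol; have [s s2] := sqrt_pchar2 (det2 (sl2_bracket x y)).
have s0 : s != 0.
  by apply: contraNneq nsol => s0; rewrite sol_bracket_sing // -s2 s0 expr0n.
case Exy: (sl2_bracket x y) => [[[p q] r] w].
have val_z : val (sl2_of (p / s, q / s, r / s, w / s)) =
    (p / s, q / s, r / s, w / s).
  apply: val_sl2_of; rewrite -(divff (expf_neq0 2 s0)) {1}s2 Exy /=.
  by rewrite mulf_div -expr2 mulf_div -expr2 -mulrBl.
move: (sl2_of _) val_z => z val_z.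
have [Ex Ey] : (x ^ z = x^-1)%g /\ (y ^ z = y^-1)%g.
  by apply: (@inverted_by_bracket _ _ _ s); rewrite Exy.
exists z; split.
(* If [z] were 1, then [x] and [y] would be their own inverses and would generate a soluble
   group. *)
- apply: contraNneq nsol => z1; apply: sol_invol; first by rewrite -Ex z1 conjg1.
  by rewrite -Ey z1 conjg1.
- by apply: sol_norm_cycle; rewrite Ex groupV cycle_id.
- by rewrite gen2C; apply: sol_norm_cycle; rewrite Ey groupV cycle_id.
Qed.

Lemma double0 (a : F) : a + a = 0.
Proof. by have := addrr_pchar2 pchar2 a. Qed.

(** * A non-soluble pair over the field of order 4, and the diameter *)

Variable t : F.
Hypothesis t2 : t ^+ 2 = t + 1.

(* Traces 0, 1 and t, for x, y and xy, are those of elements of order 2, 3 and 5. *)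
Definition sl2_x := sl2_of (t, 1, t, t).
Definition sl2_y := sl2_of (t, 0, 0, t + 1).

Lemma val_sl2_x : val sl2_x = (t, 1, t, t).
Proof. by apply: val_sl2_of => /=; rewrite -expr2 t2; ring. Qed.

Lemma val_sl2_y : val sl2_y = (t, 0, 0, t + 1).
Proof.
apply: val_sl2_of => /=; transitivity (t ^+ 2 + t); first by ring.
by rewrite t2 addrAC double0 add0r.
Qed.

Lemma sl2_xy_nonsol : ~~ solvable <<[set sl2_x; sl2_y]>>.
Proof.
(* The elements 0, 1, [t], [w] form the field of order 4; [E] collects its addition and
   multiplication tables, by which rewriting evaluates the matrix powers. *)
pose w := t + 1.
have add1t : 1 + t = w by rewrite addrC.
have addtw : t + w = 1 by rewrite addrA double0 add0r.
have add1w : 1 + w = t by rewrite addrC -addrA double0 addr0.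
have multt : t * t = w by rewrite -expr2.
have multw : t * w = 1 by rewrite mulrDr mulr1 multt addrC.
have mulww : w * w = t by rewrite {2}/w mulrDr mulr1 mulrC multw.
have addwt : w + t = 1 by rewrite addrC.
have addw1 : w + 1 = t by rewrite addrC.
have mulwt : w * t = 1 by rewrite mulrC.
have E := (add1t, erefl w : t + 1 = w, addtw, addwt, add1w, addw1, multt, multw,
  mulwt, mulww, double0, mul1r, mulr1, mul0r, mulr0, addr0, add0r).
have Ex := val_sl2_x; have Ey := val_sl2_y.
rewrite -/w in Ey; clearbody w.
apply: gen235_nonsol.
- by apply/val_inj; rewrite !expgS !valE Ex /= !E.
- by apply/val_inj; rewrite !expgS !valE Ey /= !E.
- by apply/val_inj; rewrite !expgS !valE Ex Ey /= !E.
apply/eqP=> y1; have := val_sl2_y; rewrite y1 valE => - [t1 _].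
by move: t2; rewrite -t1 expr1n double0 => /eqP; rewrite oner_eq0.
Qed.

Lemma sl2_nonsol : ~~ solvable [set: sl2 F].
Proof. by apply: contra sl2_xy_nonsol; apply: solvableS; apply: subsetT. Qed.

Lemma sl2_diameter2 : simple [set: sl2 F] ->
  soluble_graph_diameter [set: sl2 F] = Some 2%N.
Proof.
move=> simG.
have rad1 : sol_radical [set: sl2 F]%G :=: 1%g.
  have /andP[nR solR] := sol_radical_spec [set: sl2 F]%G.
  have /simpleP[_ /(_ _ nR)[//|RG]] := simG.
  by move: solR; rewrite RG (negPf sl2_nonsol).
have inV x : (x \in soluble_graph_vertices [set: sl2 F]%G) = (x != 1%g).
  by rewrite /soluble_graph_vertices rad1 !inE andbT.
have nt1 x y : ~~ solvable <<[set x; y]>> -> x != 1%g.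
  by apply: contraNneq => ->; apply: sol_norm_cycle; rewrite conj1g group1.
have nt2 x y : ~~ solvable <<[set x; y]>> -> y != 1%g.
  by rewrite gen2C; apply: nt1.
have ntneq x y : ~~ solvable <<[set x; y]>> -> x != y.
  by apply: contraNneq => ->; rewrite setUid abelian_sol ?cycle_abelian.
apply: diameter2 => [x y|]; last first.
  have nsol := sl2_xy_nonsol; exists sl2_x, sl2_y.
  by rewrite !inV /soluble_graph_adj (negPf nsol) !andbF (nt1 _ _ nsol)
    (nt2 _ _ nsol) (ntneq _ _ nsol).
rewrite !inV /soluble_graph_adj => x1 y1 xNy; rewrite !inV x1 y1 xNy /= => nsol.
have [z [z1 solxz solzy]] := common_neighbour nsol.
(* The vertex [z] differs from [x] and [y], since otherwise [solzy] or [solxz] would make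
   [<<[set x; y]>>] soluble. *)
exists z; rewrite !inV ?solxz ?solzy z1 ?x1 ?y1 andbT /=.
  by apply: contraNneq nsol => ->.
by apply: contraNneq nsol => <-.
Qed.

(** * Simplicity of SL(2, F) *)

Definition upper (u : F) : sl2 F := sl2_of (1, u, 0, 1).
Local Arguments upper u%_ring_scope.
Definition weyl : sl2 F := sl2_of (0, 1, -1, 0).

Lemma val_upper u : val (upper u) = (1, u, 0, 1).
Proof. by apply: val_sl2_of => /=; ring. Qed.

Lemma val_weyl : val weyl = (0, 1, -1, 0).
Proof. by apply: val_sl2_of => /=; ring. Qed.

(** Conjugation by [weyl] gives the lower unitriangular matrices, and a matrix with nonzero lower
    left entry is a product upper, lower, upper. *)
Lemma upper_gen (N : {group sl2 F}) :
  N <| [set: sl2 F] -> (forall u, upper u \in N) -> N :=: [set: sl2 F].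
Proof.
move=> /andP[_ /subsetP nN] Nup; apply/setP=> x; rewrite in_setT.
pose low v := (upper (- v) ^ weyl)%g.
have Nlow v : low v \in N by rewrite memJ_norm // nN // in_setT.
have val_low v : val (low v) = (1, 0, v, 1).
  rewrite /low /conjg !valE val_upper val_weyl /=.
  by congr (_, _, _, _); ring.
clearbody low; have Nc y : let: (_, _, c, _) := val y in c != 0 -> y \in N.
  case Ey: (val y) => [[[a b] c] d] c0.
  have := sl2_det y; rewrite Ey /= => /eqP; rewrite subr_eq => /eqP det_y.
  have -> : y = (upper ((a - 1) / c) * low c * upper ((d - 1) / c))%g.
    apply/val_inj; rewrite !valE val_low !val_upper Ey /=.
    have Eb : b = (a * d - 1) / c by rewrite det_y addrC addKr mulfK.
    by rewrite Eb; congr (_, _, _, _); field.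
  by rewrite !groupM.
have := Nc x; have := Nc (x * low 1%R)%g; have := sl2_det x.
rewrite valE val_low; case: (val x) => [[[a b] c] d] /= det_x.
have [c0 | c0] := eqVneq c 0; last by move=> _ ->.
(* When [c = 0], the lower left entry of [x * low 1] is [d], nonzero because [a * d = 1]. *)
move=> Nxl _; rewrite -(groupMr _ (Nlow 1)) Nxl //.
rewrite c0 mul0r add0r mulr1; apply: contra_eq_neq det_x => ->.
by rewrite c0 !mulr0 subr0 eq_sym oner_eq0.
Qed.

(** Conjugates and commutators of a nontrivial element of a normal subgroup [N] produce every
    [upper u], and then [upper_gen] applies. *)
Lemma sl2_simple : simple [set: sl2 F].
Proof.
apply/simpleP; split=> [|N nsN].
  by apply: contraNneq sl2_nonsol => ->; apply: solvable1.
have [-> | ntN] := eqVneq (N :> {set _}) 1%g; [by left | right].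
apply: (upper_gen nsN); have /andP[_ /subsetP nN] := nsN.
have NJ x g : x \in N -> (x ^ g)%g \in N.
  by move=> Nx; rewrite memJ_norm // nN // in_setT.
have NR x g : x \in N -> [~ x, g]%g \in N.
  by move=> Nx; rewrite groupM ?groupV ?NJ.
pose wit := exists2 y, y \in N & exists b c d, val y = (0, b, c, d).
have wit_b x : x \in N -> (let: (_, b, _, _) := val x in b != 0) -> wit.
  case Ex: (val x) => [[[a b] c] d] Nx b0.
  (* Conjugation by the lower unitriangular matrix of entry [- (a / b)] clears the upper left
     corner. *)
  exists (x ^ (upper (a / b) ^ weyl))%g; first exact: NJ.
  do 3!eexists; rewrite /conjg !valE val_upper val_weyl Ex /=.
  by congr (_, _, _, _); field.
have wit_c x : x \in N -> (let: (_, _, c, _) := val x in c != 0) -> wit.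
  case Ex: (val x) => [[[a b] c] d] Nx c0.
  apply: (wit_b (x ^ weyl)%g); first exact: NJ.
  rewrite /conjg !valE val_weyl Ex /=.
  by rewrite !(mul0r, mulr0, mulr1, mul1r, mulN1r, mulrN1, add0r, addr0) oppr_eq0.
(* For this y, [~ y, diag(t, t^-1)] is upper triangular, and its commutators with
   upper unitriangular matrices are all the upper unitriangular matrices. *)
have [y Ny [b [c [d Ey]]]] : wit.
  have [x Nx x1] := trivgPn _ ntN.
  case Ex: (val x) => [[[a b] c] d].
  have [b0 | b0] := eqVneq b 0; last by apply: (wit_b x); rewrite // Ex.
  have [c0 | c0] := eqVneq c 0; last by apply: (wit_c x); rewrite // Ex.
  (* Now [x] is diagonal. If it is not scalar, conjugation by [upper 1] creates the upper right
     entry [a - d]; if it is, then [a * a = 1] forces [a = 1] in characteristic 2. *)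
  have [ad | ad] := eqVneq a d; last first.
    apply: (wit_b (x ^ upper 1)%g); first exact: NJ.
    rewrite /conjg !valE val_upper Ex b0 c0 /=.
    by rewrite !(mul0r, mulr0, mulr1, mul1r, add0r, addr0) mulN1r subr_eq0.
  case/eqP: x1; apply/val_inj; rewrite Ex b0 c0 valE -ad.
  have := sl2_det x; rewrite Ex b0 c0 -ad /= mul0r subr0 => a2.
  suff -> : a = 1 by [].
  apply/eqP; rewrite -subr_eq0 -sqrf_eq0; apply/eqP.
  transitivity (a * a + 1 - (a + a)); first by ring.
  by rewrite a2 !double0 subr0.
have [w Dw] : exists w, w = t + 1 by exists (t + 1).
have tw : t * w = 1 by rewrite Dw mulrDr mulr1 -expr2 t2 addrAC double0 add0r.
have tt : t * t = w by rewrite -expr2 t2.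
have ww : w * w = t.
  by rewrite {1}Dw mulrDl tw mul1r Dw addrCA double0 addr0.
have det_y : - (b * c) = 1 by rewrite -(sl2_det y) Ey /= mul0r sub0r.
have [k Nk [e Ek]] : exists2 k, k \in N & exists e, val k = (w, e, 0, t).
  exists [~ y, sl2_y]%g; first exact: NR.
  eexists; rewrite /commg /conjg !valE Ey val_sl2_y -Dw /=.
  congr (_, _, _, _).
  - by rewrite -[w in RHS]mul1r -det_y -tt; ring.
  - by ring.
  - by rewrite -[t in RHS]mul1r -det_y -ww; ring.
(* Commutation with [k] multiplies the parameter of [upper] by [t * (w - t) = t], the inverse of
   [w]; the remaining sign vanishes in characteristic 2. *)
move=> u; have -> : upper u = [~ k, upper (- (u * w))]%g.
  apply/val_inj; rewrite /commg /conjg !valE Ek !val_upper /=.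
  congr (_, _, _, _).
  - by rewrite -[LHS]tw; ring.
  - transitivity (u * (t * w) * (t - w)); last by ring.
    by rewrite tw Dw mulr1 opprD addrA subrr add0r mulrN1 (oppr_pchar2 pchar2).
  - by ring.
  - by rewrite -[LHS]tw; ring.
exact: NR.
Qed.

Lemma sl2_nonabelian : ~~ abelian [set: sl2 F].
Proof. by apply: contra sl2_nonsol => /abelian_sol. Qed.

Lemma card_sl2_lb : (#|F| <= #|[set: sl2 F]|)%N.
Proof.
rewrite cardsT; apply: (@leq_card _ _ upper) => u v /(congr1 val).
by rewrite !val_upper => - [].
Qed.

Lemma card_sl2_ub : (#|[set: sl2 F]| <= #|F| ^ 4)%N.
Proof.
rewrite cardsT (leq_trans (leq_card (val : sl2 F -> _) val_inj)) //.
by rewrite !card_prod !expnS expn0 muln1 !mulnA.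
Qed.

End SL2Graph.

(** * The infinite family of fields and groups *)

(** By Cauchy's theorem the unit group has an element of order 3, a root of [t ^+ 2 + t + 1]. *)
Lemma root_F4 (F : finFieldType) : 2 \in [pchar F]%R -> (3 %| #|F|.-1)%N ->
  exists t : F, (t ^+ 2 = t + 1)%R.
Proof.
move=> pchar2; rewrite -card_finField_unit => /(Cauchy (isT : prime 3)) [u _ ou].
exists (val u); set t := val u.
have t3 : (t ^+ 3 = 1)%R by rewrite -FinRing.val_unitX -ou expg_order.
have t1 : (t - 1 != 0)%R.
  rewrite subr_eq0; apply: contra_eq_neq ou => t1.
  by rewrite (_ : u = 1%g) ?order1 //; apply: val_inj.
apply/eqP; rewrite -subr_eq0 -(mulrI_eq0 _ (mulfI t1)); apply/eqP.
transitivity ((t ^+ 3 - 1) - (t ^+ 2 + t ^+ 2) + (1 + 1))%R; first by ring.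
by rewrite t3 !(addrr_pchar2 pchar2) subrr subr0 addr0.
Qed.

Theorem corollary3 :
  exists (gT : nat -> finGroupType) (G : forall n : nat, {group gT n}),
    (forall n : nat,
       [/\ simple (G n), ~~ abelian (G n)
         & soluble_graph_diameter (G n) = Some 2]) /\
    (forall m n : nat, m <> n -> ~~ (G m \isog G n)).
Proof.
(* Taking q = 4 ^ (5 ^ n), the bounds q <= |SL(2, q)| <= q ^ 4 suffice to separate
   the orders. *)
have k_gt0 n : 0 < 2 * 5 ^ n by rewrite muln_gt0 expn_gt0.
pose F n : finFieldType := s2val (pPrimePowerField (isT : prime 2) (k_gt0 n)).
have pchar2 n : 2 \in [pchar (F n)]%R.
  exact: (s2valP (pPrimePowerField (isT : prime 2) (k_gt0 n))).
have card_F n : #|F n| = 4 ^ (5 ^ n).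
  by rewrite (s2valP' (pPrimePowerField (isT : prime 2) (k_gt0 n))) expnM.
have F4 n : exists t : F n, (t ^+ 2 = t + 1)%R.
  (* The number 3 = 4 - 1 divides [4 ^ k - 1 ^ k], here with [k = 5 ^ n]. *)
  apply: root_F4 => //; rewrite card_F -subn1 -[X in _ - X](exp1n (5 ^ n)).
  by rewrite subn_exp dvdn_mulr.
exists (fun n => sl2 (F n)), (fun n => [set: sl2 (F n)]%G); split=> [n|].
  have [t t2] := F4 n; have simG := sl2_simple (pchar2 n) t2.
  by split=> //; [apply: sl2_nonabelian t2 | apply: sl2_diameter2 t2 simG].
have lt_card m n : m < n -> #|[set: sl2 (F m)]| < #|[set: sl2 (F n)]|.
  move=> lt_mn; apply: leq_trans (card_sl2_lb _).
  apply: leq_ltn_trans (card_sl2_ub _) _.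
  (* On exponents of 4 this is [5 ^ m * 4 < 5 ^ m.+1 <= 5 ^ n]. *)
  rewrite !card_F -expnM ltn_exp2l // (leq_trans _ (leq_pexp2l _ lt_mn)) //.
  by rewrite expnSr ltn_pmul2l ?expn_gt0.
move=> m n /eqP; rewrite neq_ltn => /orP[] /lt_card lt_mn; apply/negP.
  by move/card_isog=> eq_mn; rewrite eq_mn ltnn in lt_mn.
by move/card_isog=> eq_mn; rewrite eq_mn ltnn in lt_mn.
Qed.
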